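(* Let $G$ be a locally compact metrizable topological group, and let $\{x_n\}_{n\in\mathbb{N}}$ be a convergent sequence in $G$ with limit $x_0$. (i) For any Haar-measurable set $T\subseteq G$ that is non-null for right Haar measure, there are a left shift $\theta(x)=cx$ (with $c\in G$) and an infinite set $\mathbb{M}\subseteq\mathbb{N}$ such that $\theta(x_0)\in T$ and $$\theta(x_m)=c x_m\in T \quad\text{for all } m\in\mathbb{M}.$$ (ii) Moreover, for non-empty density-open sets $S$ and $T$ in $G$ with $Sx_0\subseteq T$, the shift may be chosen with $c\in S$: there are $c\in S$ and an infinite $\mathbb{M}\subseteq\mathbb{N}$ with $cx_0\in T$ and $cx_m\in T$ for all $m\in\mathbb{M}$.
   Context: $|\cdot|$ denotes a right-invariant Haar measure on $G$. The Haar density topology is defined relative to a fixed differentiation basis, i.e. a neighbourhood base $(V_n)$ at $1_G$ for which the Haar Density Theorem holds (almost every point of a measurable set is a density point of it): a point $u$ is a density point of a measurable set $T$ if $|T\cap V_n u|/|V_n|\to 1$ along the basis. A set is density-open if it is measurable and all its points are density points of it. *)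

(* Defs.v *)
From HB Require Import structures.
From mathcomp Require Import all_boot all_order all_algebra.
From mathcomp Require Import all_classical all_reals all_analysis.
From mathcomp Require Import measurable_realfun.

Set Implicit Arguments.
Unset Strict Implicit.
Unset Printing Implicit Defensive.

Import Order.TTheory GRing.Theory Num.Theory.
Import numFieldNormedType.Exports.

Local Open Scope classical_set_scope.
Local Open Scope ring_scope.

HB.mixin Record isTopologicalGroup G & Topological G & Group G := {
  mulg_continuous : continuous (fun xy : G * G => (xy.1 * xy.2)%g) ;
  invg_continuous : continuous (fun x : G => (x^-1)%g) ;
}.

(* The carrier is pointed (by an arbitrary point, not necessarily 1) only
   because [g_sigma_algebraType] expects a [pointedType]. *)
#[short(type="topologicalGroupType")]
HB.structure Definition TopologicalGroup :=
  {G of PointedTopological G & Group G & isTopologicalGroup G}.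

Definition metrizable (R : realType) (T : topologicalType) : Prop :=
  exists dist : T -> T -> R,
    [/\ forall x y, dist x y = 0 <-> x = y,
        forall x y, dist x y = dist y x,
        forall x y z, dist x z <= dist x y + dist y z &
        forall x, nbhs x =
          filter_from [set e : R | 0 < e] (fun e => [set y | dist x y < e])].

Notation borel G := (g_sigma_algebraType (@open G)).

Section haar.
Context {R : realType} {G : topologicalGroupType}.
Implicit Types (mu : {measure set (borel G) -> \bar R}) (A S T : set G).

Definition rtranslate A (u : G) : set G := [set (a * u)%g | a in A].

(* Radon measures are taken here to be inner regular with respect to compact
   sets on all Borel sets. On a sigma-compact group this agrees with the
   convention "outer regular on Borel sets, inner regular on open sets"; on
   larger groups the two differ only in that locally null sets are null here. *)
Definition right_haar_measure mu : Prop :=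
  [/\ mu setT != 0%E,
      forall K : set G, compact K -> (mu K < +oo)%E,
      forall A, (@open G).-sigma.-measurable A ->
        mu A = ereal_sup
          [set mu K | K in [set K : set G | compact K /\ K `<=` A]] &
      forall A (u : G), (@open G).-sigma.-measurable A ->
        mu (rtranslate A u) = mu A].

(* [completed_algebra_gen mu] consists of the unions of a Borel set and a
   subset of a Borel null set, i.e. it is the domain of the completion of mu. *)
Definition haar_measurable mu : set (set G) := completed_algebra_gen mu.

(* The outer measure induced by mu; on Haar-measurable sets it is the
   completion of mu. *)
Definition haar mu : set G -> \bar R := (mu^*)%mu.

Definition density_point mu (V : (set G)^nat) T (u : G) : Prop :=
  (fun n => haar mu (T `&` rtranslate (V n) u) / haar mu (V n))%E
    @ \oo --> 1%E.

Definition differentiation_basis mu (V : (set G)^nat) : Prop :=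
  [/\ forall n, nbhs (1%g : G) (V n),
      forall U, nbhs (1%g : G) U -> exists n, V n `<=` U,
      forall n, haar_measurable mu (V n) &
      forall T, haar_measurable mu T ->
        mu.-negligible (T `\` density_point mu V T)].

Definition density_open mu (V : (set G)^nat) T : Prop :=
  haar_measurable mu T /\ T `<=` density_point mu V T.

End haar.

(* Main.v *)
Require Import Defs.
From mathcomp Require Import all_boot all_order all_algebra.
From mathcomp Require Import all_classical all_reals all_analysis.

Set Implicit Arguments.
Unset Strict Implicit.
Unset Printing Implicit Defensive.

Import Order.TTheory GRing.Theory Num.Theory.
Local Open Scope classical_set_scope.
Local Open Scope ring_scope.

(** By inner regularity it suffices to shift into a compact [K] of positive measure
    ([nonnegligible_compact]). Since [x0^-1 * x m] tends to 1, the heart is recurrence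
    ([compact_recurrence]): some [y] in [K] is brought back into [K] by infinitely many terms of a
    sequence tending to 1. Then [c = y * x0^-1] works ([compact_shift]). For (ii), a non-empty
    density-open [S] is non-negligible, so it contains such a [K]. Right invariance gives [K x0] the
    same measure, [K x0] lies in [T], and [c * x0] in [K x0] forces [c] into [K], hence into [S]. *)

Lemma metrizable_hausdorff (R : realType) (T : topologicalType) :
  metrizable R T -> hausdorff_space T.
Proof.
move=> [dist [dist0 distC distD nbhsE]] p q pq; apply/dist0.
apply/eqP; rewrite eq_le; apply/andP; split; last first.
  (* Nonnegativity of [dist] comes from the triangle inequality along [p], [q], [p]. *)
  have := distD p q p; rewrite (distC q p) (dist0 p p).2 // => h.
  by rewrite -(@pmulrn_lge0 _ _ 2) // mulr2n.
apply/ler_addgt0Pl => e e0; rewrite addr0.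
have ballE (z : T) : nbhs z [set y | dist z y < e / 2].
  by rewrite nbhsE; exists (e / 2) => //=; rewrite divr_gt0.
have [z [/= pz qz]] := pq _ _ (ballE p) (ballE q).
rewrite (le_trans (distD p z q)) // [leRHS]splitr.
by rewrite lerD // ltW // distC.
Qed.

Lemma cofinal_infinite_set (M : set nat) :
  (forall n, exists2 m, (n <= m)%N & M m) -> infinite_set M.
Proof.
move=> Mcof /finite_seqP[s Ms].
have [m + Mm] := Mcof (\max_(i <- s) i).+1.
by rewrite leqNgt ltnS leq_bigmax_seq//; move: Mm; rewrite Ms.
Qed.

Lemma negligible_haar (R : realType) (G : topologicalGroupType)
    (mu : {measure set (borel G) -> \bar R}) (A : set G) :
  mu.-negligible A -> haar mu A = 0%E.
Proof.
move=> [B [mB B0 AB]]; apply/eqP; rewrite eq_le; apply/andP; split.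
  by rewrite -B0 -measurable_mu_extE//; exact: le_mu_ext.
by apply: mu_ext_ge0 => X; exact: measure_ge0.
Qed.

Section topological_group.
Context {G : topologicalGroupType}.
Implicit Types (A K : set G) (u : G).

Lemma compact_mulg K L : compact K -> compact L ->
  compact [set (p.1 * p.2)%g | p in K `*` L].
Proof.
move=> cK cL; apply: continuous_compact; last exact: compact_setX.
exact/continuous_subspaceT/mulg_continuous.
Qed.

Lemma compact_rtranslate K u : compact K -> compact (rtranslate K u).
Proof.
move=> cK; have := compact_mulg cK (@compact_set1 G u); congr compact.
apply/seteqP; split=> y /=.
- by move=> [[a b] /= [Ka ->] <-]; exists a.
- by move=> [a Ka <-]; exists (a, u).
Qed.

Lemma rtranslateV A u y : rtranslate A (u^-1)%g y <-> A (y * u)%g.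
Proof.
split=> [[a Aa <-]|Ayu]; first by rewrite mulgVK.
by exists (y * u)%g => //; rewrite mulgK.
Qed.

Lemma cvg_mulgl (I : Type) (F : set_system I) {FF : Filter F} (f : I -> G) u a :
  f @ F --> a -> (fun i => (u * f i)%g) @ F --> (u * a)%g.
Proof.
move=> fa.
apply: (@continuous2_cvg _ _ _ _ _ _ (fun=> u) f (fun a b => (a * b)%g) u a).
- exact: (@mulg_continuous G (u, a)).
- exact: cvg_cst.
- exact: fa.
Qed.

Lemma closed_borel A : closed A -> (@open G).-sigma.-measurable A.
Proof.
move=> cA; rewrite -[A]setCK; apply: (@measurableC _ (borel G)).
by apply: sub_sigma_algebra; exact: closed_openC.
Qed.

End topological_group.

Section haar.
Context {R : realType} {G : topologicalGroupType}.
Variable mu : {measure set (borel G) -> \bar R}.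
Hypothesis haar_mu : right_haar_measure mu.
Implicit Types (K S T : set G) (V : (set G)^nat).

(** [T] differs from a Borel set [B] only by a negligible set, so [B] has positive measure, and
    inner regularity of [mu] at [B] supplies the compact set. *)
Lemma nonnegligible_compact T : haar_measurable mu T -> ~ mu.-negligible T ->
  exists K, [/\ compact K, K `<=` T & (0 < mu K)%E].
Proof.
move=> [B mB [N negN BNT]] nT; have [_ _ inner _] := haar_mu.
have : (0 < mu B)%E.
  rewrite lt0e measure_ge0 andbT; apply/eqP => B0; apply: nT; rewrite -BNT.
  by apply: negligibleU => //; exact/negligibleP.
rewrite inner// => /ereal_sup_gt[_ [K [cK KB] <-] K0].
by exists K; split=> //; rewrite -BNT; apply: subset_trans KB _; left.
Qed.

(** If [S] were negligible, all its density ratios would vanish, and their limit at a point of [S]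
    would be 0 instead of 1. *)
Lemma density_open_nonnegligible V S :
  density_open mu V S -> S !=set0 -> ~ mu.-negligible S.
Proof.
move=> [_ dS] [s Ss] negS; have := dS _ Ss; rewrite /density_point.
under eq_fun => n.
  rewrite negligible_haar ?mul0e; last by apply: negligibleS negS => y [].
  over.
move=> /(cvg_lim (@ereal_hausdorff _)).
by rewrite lim_cst; last exact: ereal_hausdorff; move=> /eqP; rewrite eqe eq_sym oner_eq0.
Qed.

Hypotheses (hausdorffG : hausdorff_space G) (lcG : locally_compact [set: G]).

(* The translates [K * z_k^-1], all of measure [mu K], eventually lie in a fixed
   compact set, so their limsup has measure at least [mu K > 0]; a point [y] of
   it satisfies [y * z_k \in K] infinitely often, and [y \in K] because [K] is
   closed and [z_k] tends to [1]. *)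
Lemma compact_recurrence (z : nat -> G) K :
  z @ \oo --> (1%g : G) -> compact K -> (0 < mu K)%E ->
  exists2 y, K y & infinite_set [set m | K (y * z m)%g].
Proof.
move=> z1 cK K0; have [_ fin_mu _ inv_mu] := haar_mu.
have clK : closed K by exact: compact_closed.
have mK := closed_borel clK.
have [W W1 [cW _]] : exists2 W : set G, nbhs (1%g : G) W & compact W /\ closed W.
  have [W W1 cW] := @lcG (1%g : G) I; exists W => //.
  by move: W1; rewrite within_interior ?interiorT.
have zV1 : (fun n => (z n)^-1)%g @ \oo --> (1%g : G).
  rewrite -[X in _ --> X]invg1.
  exact: (cvg_comp z (fun y => (y^-1)%g) z1 (@invg_continuous G _)).
have [N _ NW] := zV1 _ W1.
(* Dropping the first [N] terms puts every translate inside [K * W], so the whole union has finite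
   measure. *)
pose F n : set (borel G) := rtranslate K ((z (n + N)%N)^-1)%g.
have mF n : measurable (F n).
  by apply: closed_borel; apply: compact_closed => //; exact: compact_rtranslate.
pose KW := [set (p.1 * p.2)%g | p in K `*` W].
have cKW : compact KW by exact: compact_mulg.
have mU n : measurable (\bigcup_(k in [set k | (n <= k)%N]) F k).
  exact: bigcup_measurable.
have finU : (mu (\bigcup_(k in [set k | (0 <= k)%N]) F k) < +oo)%E.
  apply: le_lt_trans (fin_mu _ cKW); apply: le_measure; rewrite ?inE//.
    exact: closed_borel (compact_closed hausdorffG cKW).
  move=> y [k _ [a Ka <-]]; exists (a, (z (k + N)%N)^-1)%g => //; split=> //=.
  by apply: NW => /=; exact: leq_addl.
have leL : (mu K <= mu (lim_sup_set F))%E.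
  (* Continuity from above, by [finU]: the measures of the tail unions tend to that of the limsup,
     and each tail contains a translate of [K]. *)
  have Fcvg := lim_sup_set_cvg mu F mF finU.
  rewrite -(cvg_lim (@ereal_hausdorff _) Fcvg); apply: lime_ge.
    by apply/cvg_ex; exists (mu (lim_sup_set F)).
  apply: nearW => n; rewrite -(inv_mu K ((z (n + N)%N)^-1)%g mK).
  apply: le_measure; rewrite ?inE; [exact: mF|exact: mU|].
  by move=> y Fy; exists n => //=.
have [y Ly] : lim_sup_set F !=set0.
  apply/set0P/negP => /eqP L0; move: leL; rewrite L0 measure0 leNgt.
  by rewrite K0.
have frequently n : exists2 m, (n <= m)%N & K (y * z m)%g.
  have [k /= nk /rtranslateV ?] := Ly n I; exists (k + N)%N => //.
  by rewrite (leq_trans nk)// leq_addr.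
exists y; last exact: cofinal_infinite_set.
apply: contrapT => nKy.
have : (fun n => (y * z n)%g) @ \oo --> y.
  by rewrite -[X in _ --> X]mulg1; exact: cvg_mulgl.
move=> /(_ (~` K)) [|n _ nK].
  by apply: open_nbhs_nbhs; split=> //; exact: closed_openC.
by have [m nm Km] := frequently n; exact: nK _ nm Km.
Qed.

(** Recurrence for [z m = x0^-1 * x m]: with [c = y * x0^-1], [c * x0 = y] and
    [c * x m = y * z m]. *)
Lemma compact_shift (x : nat -> G) (x0 : G) K :
  x @ \oo --> x0 -> compact K -> (0 < mu K)%E ->
  exists c (M : set nat),
    [/\ infinite_set M, K (c * x0)%g & forall m, M m -> K (c * x m)%g].
Proof.
move=> xx0 cK K0; have z1 : (fun n => x0^-1 * x n)%g @ \oo --> (1%g : G).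
  by rewrite -[X in _ --> X](mulVg x0); exact: cvg_mulgl.
have [y Ky Minf] := compact_recurrence z1 cK K0.
exists (y * x0^-1)%g, [set m | K (y * (x0^-1 * x m))%g].
by split=> //; [rewrite mulgVK|move=> m /=; rewrite mulgA].
Qed.

End haar.

Theorem mainTheorem3 (R : realType) (G : topologicalGroupType)
    (mu : {measure set (borel G) -> \bar R})
    (x : nat -> G) (x0 : G)
    (metG : metrizable R G) (lcG : locally_compact [set: G])
    (haar_mu : right_haar_measure mu)
    (x_cvg : x @ \oo --> x0) :
  (forall T : set G, haar_measurable mu T -> ~ mu.-negligible T ->
    exists (c : G) (M : set nat),
      [/\ infinite_set M, T (c * x0)%g & forall m, M m -> T (c * x m)%g])
  /\
  (forall V : nat -> set G, differentiation_basis mu V ->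
    forall S T : set G,
      S !=set0 -> T !=set0 -> density_open mu V S -> density_open mu V T ->
      rtranslate S x0 `<=` T ->
    exists (c : G) (M : set nat),
      [/\ S c, infinite_set M, T (c * x0)%g &
          forall m, M m -> T (c * x m)%g]).
Proof.
have hG := metrizable_hausdorff metG; split.
  move=> T mT nT.
  have [K [cK KT K0]] := nonnegligible_compact haar_mu mT nT.
  have [c [M [Minf Kc KM]]] := compact_shift haar_mu hG lcG x_cvg cK K0.
  by exists c, M; split=> // [|m Mm]; apply: KT => //; exact: KM.
move=> V _ S T S0 _ dS _ ST; have [mS _] := dS.
have [K [cK KS K0]] :=
  nonnegligible_compact haar_mu mS (density_open_nonnegligible dS S0).
have [_ _ _ inv_mu] := haar_mu.
have mK : (@open G).-sigma.-measurable K
  by exact: closed_borel (compact_closed hG cK).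
have KxT : rtranslate K x0 `<=` T.
  by move=> _ [k Kk <-]; apply: ST; exists k => //; exact: KS.
have Kx0 : (0 < mu (rtranslate K x0))%E by rewrite inv_mu.
(* Shifting into [K x0], not just any compact part of [T], is what places [c] in [S]: right
   cancellation of [x0] gives [c] in [K]. *)
have [c [M [Minf Kc KM]]] :=
  compact_shift haar_mu hG lcG x_cvg (compact_rtranslate cK) Kx0.
exists c, M; split=> // [||m Mm]; last by apply: KxT; exact: KM.
- by have [k Kk /mulIg <-] := Kc; exact: KS.
- exact: KxT.
Qed.
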